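(* Let $\Gamma$ be a finite tree with vertex set $X$, let $x_0\in X$ be a base vertex, and let $T=T(x_0)$ be the Terwilliger algebra of $\Gamma$ with respect to $x_0$. Let $H=\mathrm{Aut}(\Gamma^{(x_0)})$ be the group of automorphisms of $\Gamma$ fixing $x_0$, and let $\mathrm{Orb}(H,X)$ denote the set of $H$-orbits on $X$. Then the principal $T$-module $W_0=Tx_0$ satisfies $$W_0=\mathrm{Span}\{\underline{Y}\mid Y\in \mathrm{Orb}(H,X)\},$$ where $\underline{Y}=\sum_{y\in Y} y\in V$.
   Context: For a finite connected simple graph $\Gamma$ with vertex set $X$ and a fixed base vertex $x_0\in X$, let $\partial$ be the graph distance, $D=\max\{\partial(x_0,x)\mid x\in X\}$, and $X_i=\{x\in X\mid \partial(x_0,x)=i\}$ for $0\le i\le D$. The standard module is $V=\mathbb{C}X$, the complex vector space with basis $X$, equipped with the Hermitian form making $X$ orthonormal. Let $A$ be the adjacency matrix of $\Gamma$ acting on $V$, and $E_i^*$ the orthogonal projection of $V$ onto $V_i^*=\mathbb{C}X_i$. The Terwilliger algebra $T=T(x_0)$ is the subalgebra of $\mathrm{End}(V)$ generated by $A$ and $E_0^*,\dots,E_D^*$. The principal $T$-module is $W_0=Tx_0$, the smallest $T$-submodule of $V$ containing $x_0$. $\Gamma^{(x_0)}$ denotes $\Gamma$ regarded as a rooted tree with root $x_0$. *)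

(* Defs.v *)
From HB Require Import structures.
From mathcomp Require Import all_boot all_order all_algebra all_fingroup.
From mathcomp Require Import reals complex.

Set Implicit Arguments.
Unset Strict Implicit.
Unset Printing Implicit Defensive.

Import GRing.Theory Num.Theory.
Local Open Scope ring_scope.

(** * Trees *)

Section Graph.
Variables (X : finType) (e : rel X).

Definition simple_graph : Prop := symmetric e /\ irreflexive e.

Definition connected_graph : Prop := forall x y : X, connect e x y.

(* [ucycle e c]: the vertices of [c] are pairwise distinct and cyclically
   adjacent; an edge gives such a [c] of size 2, which is not a cycle. *)
Definition acyclic_graph : Prop := forall c : seq X, ucycle e c -> (size c <= 2)%N.

Definition is_tree : Prop :=
  [/\ simple_graph, connected_graph & acyclic_graph].

Definition walk_of_length (x y : X) (n : nat) : bool :=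
  [exists p : n.-tuple X, path e x p && (last x p == y)].

(* The least length of a walk from x to y; a shortest walk has length less than
   #|X|, and the value is #|X| when y is unreachable from x. *)
Definition gdist (x y : X) : nat :=
  find (walk_of_length x y) (iota 0 #|X|).

Definition ecc (x0 : X) : nat := (\max_(x : X) gdist x0 x)%N.

Definition sphere (x0 : X) (i : nat) : {set X} := [set x | gdist x0 x == i].

Lemma gdist_le (x y : X) (n : nat) : walk_of_length x y n -> (gdist x y <= n)%N.
Proof.
move=> wn; rewrite leqNgt; apply/negP => lt_n.
have ltX : (n < #|X|)%N.
  by apply: leq_trans lt_n _; rewrite -[X in (_ <= X)%N](size_iota 0) find_size.
by have := before_find 0%N lt_n; rewrite nth_iota // add0n wn.
Qed.

Lemma gdist_walk (x y : X) : connect e x y -> walk_of_length x y (gdist x y).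
Proof.
case/connectP=> p0 e_p0 ->; case: (shortenP e_p0) => p e_p Up _.
have lt_p : (size p < #|X|)%N.
  by rewrite -[(_ < _)%N]/(size (x :: p) <= _)%N -(card_uniqP Up) max_card.
have hw : has (walk_of_length x (last x p)) (iota 0 #|X|).
  apply/hasP; exists (size p); first by rewrite mem_iota.
  by apply/existsP; exists (in_tuple p); rewrite e_p /=.
have := nth_find 0%N hw; rewrite nth_iota ?add0n //.
by rewrite -[X in (_ < X)%N](size_iota 0) -has_find.
Qed.

(* Aut(Gamma^(x0)), as a group of permutations of the vertices. *)
Definition rooted_aut (x0 : X) : {set {perm X}} :=
  [set s : {perm X} | (s x0 == x0) &&
     [forall x, forall y, e (s x) (s y) == e x y]].

Lemma rooted_aut_group_set (x0 : X) : group_set (rooted_aut x0).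
Proof.
apply/group_setP; split=> [|s t].
  by rewrite inE perm1 eqxx; apply/forallP=> x; apply/forallP=> y; rewrite !perm1.
rewrite !inE => /andP[/eqP s0 /forallP sP] /andP[/eqP t0 /forallP tP].
rewrite permM s0 t0 eqxx; apply/forallP=> x; apply/forallP=> y; rewrite !permM.
by rewrite (eqP (forallP (tP _) _)) (eqP (forallP (sP _) _)).
Qed.

Canonical rooted_aut_group (x0 : X) : {group {perm X}} :=
  Group (rooted_aut_group_set x0).

(* Orb(H, X) for H = Aut(Gamma^(x0)) under the natural action. *)
Definition rooted_orbits (x0 : X) : {set {set X}} :=
  orbit 'P (rooted_aut x0) @: [set: X].

End Graph.

(** * The standard module *)

(* CX, as the space of coordinate functions, with C = R[i] for R : realType. *)
Notation stdmod R X := {ffun X -> (R[i])^o}.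

Section StandardModule.
Variables (R : realType) (X : finType).
Local Notation V := (stdmod R X).

Definition vtx (y : X) : V := [ffun x => (x == y)%:R].

Definition vsum (Y : {set X}) : V := \sum_(y in Y) vtx y.

Definition hform (u v : V) : R[i] := \sum_x u x * (v x)^*.

Lemma hform_vtx (x y : X) : hform (vtx x) (vtx y) = (x == y)%:R.
Proof.
rewrite /hform (bigD1 x) //= big1 ?addr0 => [|z /negPf zx]; last first.
  by rewrite !ffunE zx mul0r.
by rewrite !ffunE eqxx mul1r conjC_nat.
Qed.

Lemma stdmodE (v : V) : v = \sum_y v y *: vtx y.
Proof.
apply/ffunP=> x; rewrite sum_ffunE (bigD1 x) //= big1 ?addr0 => [|z zx].
  by rewrite !ffunE eqxx [RHS]mulr1.
by rewrite !ffunE eq_sym (negPf zx) [LHS]mulr0.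
Qed.

Variable e : rel X.

Definition adj_fun (v : V) : V := [ffun x => \sum_y (e x y)%:R * v y].

Fact adj_fun_linear : linear adj_fun.
Proof.
move=> a u v; apply/ffunP=> x; rewrite !ffunE scaler_sumr -big_split /=.
by apply: eq_bigr => y _; rewrite !ffunE mulrDr; congr (_ + _); exact: mulrCA.
Qed.
HB.instance Definition _ :=
  GRing.isLinear.Build R[i] V V _ adj_fun adj_fun_linear.

Definition adjop : 'End(V) := linfun adj_fun.

Lemma adjop_vtx (y : X) : adjop (vtx y) = \sum_(x | e x y) vtx x.
Proof.
rewrite lfunE /=; apply/ffunP=> x; rewrite !ffunE sum_ffunE (bigD1 y) //=.
rewrite big1 ?addr0 => [|z zy]; last by rewrite !ffunE (negPf zy) mulr0.
rewrite ffunE eqxx mulr1; case: (boolP (e x y)) => exy.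
  rewrite (bigD1 x) //= big1 ?addr0 ?ffunE ?eqxx // => z /andP[_ zx].
  by rewrite ffunE eq_sym (negPf zx).
rewrite big1 // => z ezy; rewrite ffunE; case: eqP => // xz.
by rewrite xz ezy in exy.
Qed.

(* The orthogonal projection of CX onto CY, see [coord_projP]. *)
Definition coord_proj_fun (Y : {set X}) (v : V) : V :=
  [ffun x => if x \in Y then v x else 0].

Fact coord_proj_fun_linear (Y : {set X}) : linear (coord_proj_fun Y).
Proof.
move=> a u v; apply/ffunP=> x; rewrite !ffunE.
by case: ifP => // _; rewrite scaler0 addr0.
Qed.
HB.instance Definition _ (Y : {set X}) :=
  GRing.isLinear.Build R[i] V V _ (coord_proj_fun Y) (coord_proj_fun_linear Y).

Definition coord_proj (Y : {set X}) : 'End(V) := linfun (coord_proj_fun Y).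

Definition coord_space (Y : {set X}) : {vspace V} :=
  <<[seq vtx y | y in Y]>>%VS.

Lemma coord_projP (Y : {set X}) (v : V) :
  coord_proj Y v \in coord_space Y /\
  (forall u, u \in coord_space Y -> hform (v - coord_proj Y v) u = 0).
Proof.
rewrite lfunE /=; split.
  rewrite [coord_proj_fun _ _]stdmodE; apply: memv_suml => y _; rewrite ffunE.
  case: ifP => Yy; last by rewrite scale0r mem0v.
  by apply/memvZ/memv_span/imageP; exists y.
move=> u /coord_span ->; rewrite /hform big1 // => x _; rewrite !ffunE.
case: ifP => Yx; first by rewrite subrr mul0r.
rewrite sum_ffunE big1 ?conjC0 ?mulr0 // => i _; rewrite !ffunE.
have /imageP[y Yy ->] : [seq vtx y | y in Y]`_i \in [seq vtx y | y in Y].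
  by apply: mem_nth; have := ltn_ord i; rewrite size_image.
rewrite ffunE; case: eqP => [xy|_]; last exact: mulr0.
by rewrite xy Yy in Yx.
Qed.

(** * The Terwilliger algebra *)

(* The unital subalgebra of End(V) generated by G. *)
Inductive gen_alg (G : 'End(V) -> Prop) : 'End(V) -> Prop :=
| gen_alg_gen f of G f : gen_alg G f
| gen_alg_id : gen_alg G \1%VF
| gen_alg_scale (a : R[i]) f of gen_alg G f : gen_alg G (a *: f)
| gen_alg_add f g of gen_alg G f & gen_alg G g : gen_alg G (f + g)
| gen_alg_comp f g of gen_alg G f & gen_alg G g : gen_alg G (f \o g)%VF.

Variable x0 : X.

Definition dual_idem (i : nat) : 'End(V) := coord_proj (sphere e x0 i).

Definition terwilliger : 'End(V) -> Prop :=
  gen_alg (fun f => f = adjop \/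
                    exists2 i : nat, (i <= ecc e x0)%N & f = dual_idem i).

(* W_0 = T x0, as a subset of V. *)
Definition principal_module (v : V) : Prop :=
  exists2 t : 'End(V), terwilliger t & v = t (vtx x0).

End StandardModule.

(* Main.v *)
(** Let D be the algebra of functions g on X whose multiplication operator lies
in T.  It is closed under summation over children, since lowering, multiplying
by g and raising compose to multiplication by the child sum of g.  Call two
vertices equivalent if no function of D separates them.  By interpolation the
indicators of the equivalence classes are in D, so equivalent vertices have the
same number of children in each class; matching children class by class, level
after level, extends the exchange of two equivalent siblings to an automorphism
of the rooted tree.  Hence the orbit of x <> x0 consists of the vertices
equivalent to x whose parent is in the orbit of the parent of x, and its
indicator is obtained from that of the parent orbit by raising and then
multiplying by an element of D.  Conversely T commutes with Aut(Gamma^(x0)), so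
every vector of T x0 is invariant, that is, constant on orbits. *)

Require Import Defs.
From mathcomp Require Import all_boot all_order all_algebra all_fingroup.
From mathcomp Require Import reals complex boolp.

Set Implicit Arguments.
Unset Strict Implicit.
Unset Printing Implicit Defensive.

(** * Rooted trees *)

Section RootedTree.
Variables (X : finType) (e : rel X) (x0 : X).
Hypothesis tree_e : is_tree e.

Local Notation d := (gdist e x0).

Let e_sym : symmetric e. Proof. by case: tree_e => -[]. Qed.
Let e_conn x y : connect e x y. Proof. by case: tree_e => _ + _; apply. Qed.
Let e_acyclic c : ucycle e c -> size c <= 2.
Proof. by case: tree_e => _ _; apply. Qed.

(** * Levels and parents *)

Lemma gdist_root : d x0 = 0.
Proof.
apply/eqP; rewrite -leqn0; apply: gdist_le.
by apply/existsP; exists [tuple]; rewrite /= eqxx.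
Qed.

Lemma gdist_eq0 x : (d x == 0) = (x == x0).
Proof.
apply/eqP/eqP => [dx|->]; last exact: gdist_root.
have := gdist_walk (e_conn x0 x); rewrite dx => /existsP[p].
by rewrite tuple0 /= eq_sym => /eqP.
Qed.

Lemma gdist_edge x y : e x y -> d y <= (d x).+1.
Proof.
move=> exy; have /existsP[p /andP[pp /eqP lp]] := gdist_walk (e_conn x0 x).
apply: gdist_le; apply/existsP; exists [tuple of rcons p y].
by rewrite /= rcons_path pp last_rcons lp exy eqxx.
Qed.

Lemma gdist_pred x : x != x0 -> exists2 p, e p x & d x = (d p).+1.
Proof.
rewrite -gdist_eq0; case dx: (d x) => [//|n] _.
have := gdist_walk (e_conn x0 x); rewrite dx => /existsP[q].
case: q => q /= /eqP sq; case/lastP: q sq => [//|q z].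
rewrite size_rcons rcons_path last_rcons => -[sq] /andP[/andP[pq ez] /eqP zx].
rewrite {}zx in ez; exists (last x0 q) => //; congr _.+1.
apply/eqP; rewrite eqn_leq -ltnS -dx gdist_edge //=.
apply: gdist_le; apply/existsP; exists (tcast sq (in_tuple q)).
by rewrite val_tcast /= pq eqxx.
Qed.

(* The root is its own parent. *)
Definition parent c : X := odflt c [pick p | e p c && (d c == (d p).+1)].

Definition child z c : bool := (c != x0) && (parent c == z).

Lemma parentP c : c != x0 -> e (parent c) c /\ d c = (d (parent c)).+1.
Proof.
move=> c0; rewrite /parent; case: pickP => [p /andP[epc /eqP->] //|no_p].
by have [p epc dc] := gdist_pred c0; have := no_p p; rewrite epc dc eqxx.
Qed.

Lemma child_parent c : c != x0 -> child (parent c) c.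
Proof. by move=> c0; rewrite /child c0 eqxx. Qed.

Lemma parent_ind (P : X -> Prop) :
  P x0 -> (forall c, c != x0 -> P (parent c) -> P c) -> forall c, P c.
Proof.
move=> P0 PS c; elim: {c}(d c) {-2}c (erefl (d c)) => [|n IHn] c dc.
  by move/eqP: dc; rewrite gdist_eq0 => /eqP->.
have c0 : c != x0 by rewrite -gdist_eq0 dc.
by apply: PS => //; apply: IHn; have [_] := parentP c0; rewrite dc => -[].
Qed.

(** * Absence of edges inside a level, and uniqueness of parents *)

Definition lower_edge n : rel X :=
  [rel x y | [&& e x y, d x != d y, d x <= n & d y <= n]].

Lemma lower_edge_sym n : symmetric (lower_edge n).
Proof.
move=> x y; rewrite /lower_edge /= e_sym eq_sym.
by congr (_ && (_ && _)); rewrite andbC.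
Qed.

Lemma lower_edge_root n x : d x <= n -> connect (lower_edge n) x0 x.
Proof.
elim/parent_ind: x => [|x x_neq0 IHx] dx; first exact: connect0.
have [epx dpx] := parentP x_neq0.
have dp : d (parent x) <= n by apply: leq_trans dx; rewrite dpx.
apply: connect_trans (IHx dp) (connect1 _).
by rewrite /lower_edge /= epx dp dx dpx ltn_eqF.
Qed.

Lemma lower_edge_path n x y : d x <= n -> d y <= n ->
  exists p, [/\ path (lower_edge n) x p, y = last x p & uniq (x :: p)].
Proof.
move=> dx dy; have : connect (lower_edge n) x y.
  apply: connect_trans (lower_edge_root dy).
  by rewrite (sym_connect_sym (@lower_edge_sym n)) lower_edge_root.
by case/connectP=> p0 /shortenP[p pp Up _] ->; exists p.
Qed.

Lemma lower_edge_sub n : subrel (lower_edge n) e.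
Proof. by move=> x y /andP[]. Qed.

(** If x and y were on one level, a simple path between them along [lower_edge] would avoid the edge
    xy, and with it close a cycle of length at least 3. *)
Lemma gdist_edge_neq x y : e x y -> d x != d y.
Proof.
move=> exy; apply/eqP => dxy.
have [//||p [pp yl Up]] := @lower_edge_path (d x) x y; first by rewrite dxy.
have ucp : ucycle e (x :: p).
  rewrite /ucycle Up andbT /= rcons_path -yl e_sym exy andbT.
  exact: sub_path (@lower_edge_sub _) _ _ pp.
have := e_acyclic ucp; case: p pp yl {Up ucp} => [_ yx _|a [|//] /=].
  by case: tree_e => -[_ irr] _ _; rewrite yx irr in exy.
by case/andP=> /and4P[_ + _ _] _ ya _; rewrite -ya dxy eqxx.
Qed.

(** A simple path from p to q that never goes below their common level misses x, so x closes it to a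
    cycle unless p = q. *)
Lemma gdist_pred_uniq p q x :
  e p x -> e q x -> d x = (d p).+1 -> d x = (d q).+1 -> p = q.
Proof.
move=> epx eqx dp dq; have dqp : d q = d p by apply/succn_inj; rewrite -dp.
have [//||r [pr ql Ur]] := @lower_edge_path (d p) p q; first by rewrite dqp.
have all_r : all (fun z => d z <= d p) (p :: r).
  rewrite /= leqnn /=; move: (d p) pr => n.
  elim: r p {ql Ur epx dp dqp} => //= u r IHr p.
  by case/andP=> /and4P[_ _ _ ->] /IHr.
have ucr : ucycle e [:: x, p & r].
  rewrite /ucycle cons_uniq Ur andbT; apply/andP; split; last first.
    by apply/negP => /(allP all_r); rewrite dp ltnn.
  rewrite /= e_sym epx rcons_path -ql eqx andbT.
  exact: sub_path (@lower_edge_sub _) _ _ pr.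
by have := e_acyclic ucr; case: r ql {pr Ur all_r ucr}.
Qed.

Lemma childE z c : child z c = e z c && (d c == (d z).+1).
Proof.
apply/andP/andP => [[c0 /eqP <-]|[ezc /eqP dc]].
  by have [-> ->] := parentP c0.
have c0 : c != x0 by rewrite -gdist_eq0 dc.
split=> //; have [epc dpc] := parentP c0.
by apply/eqP/(gdist_pred_uniq epc ezc).
Qed.

Lemma edge_child x y : e x y = child x y || child y x.
Proof.
rewrite !childE [e y x]e_sym; case exy: (e x y) => //=; apply/esym.
have le_yx := gdist_edge exy.
have le_xy : d x <= (d y).+1 by apply: gdist_edge; rewrite e_sym.
have := gdist_edge_neq exy; rewrite neq_ltn !eqn_leq le_yx le_xy.
by case/orP => ->; rewrite ?orbT.
Qed.

(** * Matching the children of equivalent vertices *)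

Section Matching.
Variable r : rel X.
Hypothesis r_refl : reflexive r.
Hypothesis r_sym : symmetric r.
Hypothesis r_trans : transitive r.
Hypothesis r_count : forall z z' w, r z z' ->
  #|[set c | child z c & r w c]| = #|[set c | child z' c & r w c]|.

Let cls z c : {set X} := [set k | child z k & r c k].

Definition child_match z z' c : X :=
  nth c (enum (cls z' c)) (index c (enum (cls z c))).

Lemma child_match_lt z z' c :
  r z z' -> child z c -> index c (enum (cls z c)) < #|cls z' c|.
Proof.
move=> rz zc; rewrite -(r_count c rz) cardE index_mem mem_enum.
by rewrite inE zc r_refl.
Qed.

Lemma child_matchP z z' c : r z z' -> child z c ->
  child z' (child_match z z' c) && r c (child_match z z' c).
Proof.
move=> rz zc.
have : child_match z z' c \in enum (cls z' c).
  by apply: mem_nth; rewrite -cardE child_match_lt.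
by rewrite mem_enum inE.
Qed.

(** Both c and c' are equivalent to the common image, so they are looked up in the same
    duplicate-free lists, and equal images force equal positions. *)
Lemma child_match_inj z z' c c' : r z z' -> child z c -> child z c' ->
  child_match z z' c = child_match z z' c' -> c = c'.
Proof.
move=> rz zc zc' eq_m.
have /andP[_ rc] := child_matchP rz zc.
have /andP[_ rc'] := child_matchP rz zc'.
have rcc' : r c c' by apply: r_trans rc _; rewrite eq_m r_sym.
have eq_cls u : cls u c = cls u c'.
  apply/setP=> k; rewrite !inE; congr (_ && _); apply/idP/idP => rk.
    by apply: r_trans rk; rewrite r_sym.
  exact: r_trans rk.
have lt_c := child_match_lt rz zc; have lt_c' := child_match_lt rz zc'.
move: eq_m lt_c lt_c'; rewrite /child_match -!eq_cls !cardE => eq_m lt_c lt_c'.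
rewrite [RHS](set_nth_default c) // in eq_m.
move/(congr1 (index^~ (enum (cls z' c)))): eq_m.
rewrite !index_uniq ?enum_uniq // => eq_i.
by apply: (index_inj c) eq_i; rewrite mem_enum inE ?zc ?zc' ?r_refl ?rcc'.
Qed.

Lemma child_match_id z c : child z c -> child_match z z c = c.
Proof. by move=> zc; rewrite /child_match nth_index // mem_enum inE zc r_refl. Qed.

(** * Extending an exchange of equivalent siblings to an automorphism *)

Section Swap.
Variables p a b : X.
Hypotheses (pa : child p a) (pb : child p b) (rab : r a b).

(** The counter n is meant to be the level of c. The transposition of a and b follows the matching
    at every level; it preserves parents and classes, as a and b are equivalent siblings. *)
Fixpoint swap_rec n c : X :=
  if n is m.+1 then
    tperm a b (child_match (parent c) (swap_rec m (parent c)) c)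
  else c.

Definition swap c : X := swap_rec (d c) c.

Lemma swap_root : swap x0 = x0.
Proof. by rewrite /swap gdist_root. Qed.

Lemma swapE c : c != x0 ->
  swap c = tperm a b (child_match (parent c) (swap (parent c)) c).
Proof. by move=> c0; rewrite /swap; have [_ ->] := parentP c0. Qed.

Lemma tperm_child z c : child z (tperm a b c) = child z c.
Proof.
case/andP: pa pb => a0 /eqP pa' /andP[b0 /eqP pb'].
by case: tpermP => // ->; rewrite /child a0 b0 pa' pb'.
Qed.

Lemma tperm_class w c : r w c -> r w (tperm a b c).
Proof.
by case: tpermP => // -> rw; apply: r_trans rw _; rewrite // r_sym.
Qed.

Lemma swap_class c : r c (swap c).
Proof.
elim/parent_ind: c => [|c c0 IHc]; first by rewrite swap_root.
rewrite swapE // tperm_class //.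
by have /andP[] := child_matchP IHc (child_parent c0).
Qed.

Lemma swap_child c : c != x0 -> child (swap (parent c)) (swap c).
Proof.
move=> c0; rewrite [swap c]swapE // tperm_child.
by have /andP[] := child_matchP (swap_class (parent c)) (child_parent c0).
Qed.

Lemma swap_eq_root c : (swap c == x0) = (c == x0).
Proof.
case: (eqVneq c x0) => [->|c0]; first by rewrite swap_root eqxx.
by have /andP[/negPf] := swap_child c0.
Qed.

Lemma parent_swap c : c != x0 -> parent (swap c) = swap (parent c).
Proof. by move=> /swap_child /andP[_ /eqP]. Qed.

(** Equal images have equal parents, so by induction c and c' are siblings, and the matching is
    injective on siblings. *)
Lemma swap_inj : injective swap.
Proof.
elim/parent_ind=> [|c c0 IHc] c'.
  by rewrite swap_root => /esym /eqP; rewrite swap_eq_root => /eqP.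
move=> eq_s; have c'0 : c' != x0 by rewrite -swap_eq_root -eq_s swap_eq_root.
have eq_p : parent c = parent c' by apply: IHc; rewrite -!parent_swap ?eq_s.
move: eq_s; rewrite [swap c]swapE // [swap c']swapE // -eq_p => /perm_inj.
apply: child_match_inj (swap_class _) (child_parent c0) _.
by rewrite eq_p child_parent.
Qed.

Lemma swap_childE x y : child (swap x) (swap y) = child x y.
Proof.
rewrite /child swap_eq_root; case: (eqVneq y x0) => //= y0.
by rewrite parent_swap // (inj_eq swap_inj).
Qed.

(** Matching the children of a fixed vertex with themselves is the identity, and a, b lie one level
    below p. *)
Lemma swap_fix c : d c <= d p -> swap c = c.
Proof.
elim/parent_ind: c => [|c c0 IHc] dc; first exact: swap_root.
have [_ dpc] := parentP c0.
have da k : child p k -> k != c.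
  rewrite childE => /andP[_ /eqP dk]; apply/eqP=> kc.
  by rewrite -kc dk ltnn in dc.
rewrite swapE // IHc; last by rewrite ltnW // -dpc.
by rewrite child_match_id ?child_parent // tpermD // da.
Qed.

Lemma swap_transport : exists2 s, s \in rooted_aut e x0 & s a = b.
Proof.
exists (perm swap_inj); last first.
  have /andP[a0 /eqP par_a] := pa.
  by rewrite permE swapE // par_a swap_fix // child_match_id // tpermL.
rewrite inE permE swap_root eqxx; apply/forallP=> x; apply/forallP=> y.
by rewrite !permE !edge_child !swap_childE.
Qed.

End Swap.
End Matching.
End RootedTree.

Import GRing.Theory Num.Theory.
Local Open Scope ring_scope.

(** * Diagonal operators and the principal module *)

Section PrincipalModule.
Variables (R : realType) (X : finType) (e : rel X) (x0 : X).
Hypothesis tree_e : is_tree e.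

Local Notation V := (stdmod R X).
Local Notation T := (@terwilliger R X e x0).
Local Notation d := (gdist e x0).
Local Notation child := (child e x0).
Local Notation parent := (parent e x0).

(** * Raising and lowering operators in T *)

Lemma terwilliger0 : T 0.
Proof. by rewrite -(scale0r \1%VF); apply: gen_alg_scale; apply: gen_alg_id. Qed.

Lemma terwilliger_sum n (F : 'I_n -> 'End(V)) :
  (forall i, T (F i)) -> T (\sum_i F i).
Proof.
move=> TF; elim/big_ind: _ => // [|f g]; first exact: terwilliger0.
exact: gen_alg_add.
Qed.

Lemma gdist_ecc x : (d x <= ecc e x0)%N.
Proof. exact: leq_bigmax. Qed.

Lemma adjopE (v : V) x : adjop R e v x = \sum_y (e x y)%:R * v y.
Proof. by rewrite lfunE ffunE. Qed.

Lemma dual_idemE i (v : V) x :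
  dual_idem R e x0 i v x = if d x == i then v x else 0.
Proof. by rewrite lfunE ffunE inE. Qed.

(** The block $E_i^* A E_j^*$ of the adjacency operator. *)
Definition layer_op i j : 'End(V) :=
  (dual_idem R e x0 i \o (adjop R e \o dual_idem R e x0 j))%VF.

Lemma layer_op_terwilliger i j :
  (i <= ecc e x0)%N -> (j <= ecc e x0)%N -> T (layer_op i j).
Proof.
move=> le_i le_j; apply: gen_alg_comp; last apply: gen_alg_comp.
- by apply: gen_alg_gen; right; exists i.
- by apply: gen_alg_gen; left.
- by apply: gen_alg_gen; right; exists j.
Qed.

Lemma layer_opE i j (v : V) x : layer_op i j v x =
  if d x == i then \sum_(y | e x y && (d y == j)) v y else 0.
Proof.
rewrite !comp_lfunE dual_idemE adjopE; case: ifP => // _.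
rewrite [RHS]big_mkcond; apply: eq_bigr => y _; rewrite dual_idemE.
by case: (e x y); case: eqP; rewrite ?mulr0 ?mul0r ?mul1r.
Qed.

Lemma raising_op : exists2 t, T t & forall (v : V) x,
  t v x = if x == x0 then 0 else v (parent x).
Proof.
(* With i < D both i and i + 1 index generators of T. At x only the block from the level of its
   parent contributes. *)
exists (\sum_(i < ecc e x0) layer_op i.+1 i) => [|v x].
  by apply: terwilliger_sum => i; apply: layer_op_terwilliger => //; apply: ltnW.
rewrite sum_lfunE sum_ffunE; case: eqVneq => [->|x_neq0].
  by rewrite big1 // => i _; rewrite layer_opE gdist_root.
have [epx dx] := parentP tree_e x_neq0.
have ltp : (d (parent x) < ecc e x0)%N by rewrite -dx gdist_ecc.
rewrite (bigD1 (Ordinal ltp)) //= big1 ?addr0 => [|i ip]; last first.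
  rewrite layer_opE dx eqSS; case: eqP => // di; case/eqP: ip.
  exact: val_inj.
rewrite layer_opE dx eqxx (big_pred1 (parent x)) // => y.
rewrite -(eqSS (d y)) [_.+1 == _]eq_sym -dx; case: tree_e => -[e_sym _] _ _.
rewrite e_sym -(childE x0 tree_e).
(* Restoring the conjunct [x != x0] turns the right side into [child y x]. *)
by rewrite -[RHS]/(y == parent x) eq_sym -[RHS]andTb -x_neq0.
Qed.

Lemma lowering_op : exists2 t, T t & forall (v : V) x,
  t v x = \sum_(c | child x c) v c.
Proof.
exists (\sum_(i < ecc e x0) layer_op i i.+1) => [|v x].
  by apply: terwilliger_sum => i; apply: layer_op_terwilliger => //; apply: ltnW.
rewrite sum_lfunE sum_ffunE (eq_bigl _ _ (childE x0 tree_e x)).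
have [lt_x|le_x] := ltnP (d x) (ecc e x0).
  rewrite (bigD1 (Ordinal lt_x)) //= big1 ?addr0 => [|i ix].
    by rewrite layer_opE eqxx.
  by rewrite layer_opE; case: eqP => // di; case/eqP: ix; apply: val_inj.
(* On the deepest level there are no children, and no block of the sum ends there. *)
rewrite [RHS]big1 => [|c /andP[_ /eqP dc]]; last first.
  by have := gdist_ecc c; rewrite dc ltnNge le_x.
rewrite big1 // => i _; rewrite layer_opE; case: eqP => // di.
by move: (ltn_ord i); rewrite -di ltnNge le_x.
Qed.

(** * The algebra of functions acting diagonally in T *)

Definition diagonal (g : X -> R[i]) : Prop :=
  exists2 t, T t & forall (v : V) x, t v x = g x * v x.

Lemma diagonal_ext g h : g =1 h -> diagonal g -> diagonal h.
Proof. by move=> gh [t Tt tE]; exists t => // v x; rewrite tE gh. Qed.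

Lemma diagonal_cst a : diagonal (fun=> a).
Proof.
exists (a *: \1%VF) => [|v x]; first exact/gen_alg_scale/gen_alg_id.
by rewrite scale_lfunE id_lfunE ffunE.
Qed.

Lemma diagonalD g h :
  diagonal g -> diagonal h -> diagonal (fun x => g x + h x).
Proof.
move=> [t Tt tE] [s Ts sE]; exists (t + s) => [|v x].
  exact: gen_alg_add.
by rewrite add_lfunE ffunE tE sE mulrDl.
Qed.

Lemma diagonalM g h :
  diagonal g -> diagonal h -> diagonal (fun x => g x * h x).
Proof.
move=> [t Tt tE] [s Ts sE]; exists (t \o s)%VF => [|v x].
  exact: gen_alg_comp.
by rewrite comp_lfunE tE sE mulrA.
Qed.

Lemma diagonal_prod (I : finType) (P : pred I) (g : I -> X -> R[i]) :
  (forall i, P i -> diagonal (g i)) -> diagonal (fun x => \prod_(i | P i) g i x).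
Proof.
move=> Dg; elim: (index_enum I) => [|i s IHs].
  by apply: diagonal_ext (diagonal_cst 1) => x; rewrite big_nil.
case: (boolP (P i)) => Pi.
  apply: diagonal_ext (diagonalM (Dg i Pi) IHs) => x.
  by rewrite big_cons Pi.
by apply: diagonal_ext IHs => x; rewrite big_cons (negPf Pi).
Qed.

(* Lowering after raising multiplies by a function, as all children of x have
   the parent x. *)
Lemma diagonal_child_sum g :
  diagonal g -> diagonal (fun x => \sum_(c | child x c) g c).
Proof.
move=> [t Tt tE]; have [l Tl lE] := lowering_op; have [r Tr rE] := raising_op.
exists (l \o (t \o r))%VF => [|v x]; first by do !apply: gen_alg_comp.
rewrite !comp_lfunE lE mulr_suml; apply: eq_bigr => c /andP[c0 /eqP pc].
by rewrite tE rE (negPf c0) pc.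
Qed.

(** * Classes of vertices not separated by this algebra *)

Definition diag_eq x y : bool := `[< forall g, diagonal g -> g x = g y >].

Lemma diag_eqP x y : reflect (forall g, diagonal g -> g x = g y) (diag_eq x y).
Proof. exact: asboolP. Qed.

Lemma diag_eq_refl : reflexive diag_eq.
Proof. by move=> x; apply/diag_eqP. Qed.

Lemma diag_eq_sym : symmetric diag_eq.
Proof.
by move=> x y; apply/diag_eqP/diag_eqP => xy g Dg; rewrite xy.
Qed.

Lemma diag_eq_trans : transitive diag_eq.
Proof.
move=> y x z /diag_eqP xy /diag_eqP yz; apply/diag_eqP => g Dg.
by rewrite xy // yz.
Qed.

(* Lagrange interpolation in the algebra of diagonal operators. *)
Lemma diagonal_class w : diagonal (fun x => (diag_eq w x)%:R).
Proof.
(* A separating function, rescaled to be 1 at w and 0 at y, is chosen for each y outside the class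
   of w; their product is the indicator. *)
have sep y : {h | diagonal h /\ (~~ diag_eq w y -> h w = 1 /\ h y = 0)}.
  apply: cid; case: (boolP (diag_eq w y)) => [_|ny].
    by exists (fun=> 1); split=> //; apply: diagonal_cst.
  have [g Dg gwy] : exists2 g, diagonal g & g w != g y.
    move/diag_eqP/existsNP: ny => [g /not_implyP[Dg /eqP gwy]].
    by exists g.
  exists (fun x => (g w - g y)^-1 * (g x - g y)); split.
    apply: diagonalM (diagonal_cst _) _.
    exact: diagonalD Dg (diagonal_cst _).
  by move=> _; rewrite subrr mulr0 mulVf // subr_eq0.
have DP : diagonal (fun x => \prod_(y | ~~ diag_eq w y) sval (sep y) x).
  by apply: diagonal_prod => y _; case: (sep y) => h /= [].
apply: diagonal_ext DP => x; case: (boolP (diag_eq w x)) => [wx|nwx].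
  rewrite big1 // => y nwy; case: (sep y) => h /= [Dh /(_ nwy)[<- _]].
  by rewrite (diag_eqP _ _ wx).
rewrite (bigD1 x) //=; case: (sep x) => h /= [_ /(_ nwx)[_ ->]].
by rewrite mul0r.
Qed.

(** The count is the child sum of a class indicator, hence itself a diagonal function. *)
Lemma diag_eq_count z z' w : diag_eq z z' ->
  #|[set c | child z c & diag_eq w c]| = #|[set c | child z' c & diag_eq w c]|.
Proof.
move=> /diag_eqP/(_ _ (diagonal_child_sum (diagonal_class w))).
have cnt u : \sum_(c | child u c) (diag_eq w c)%:R =
             #|[set c | child u c & diag_eq w c]|%:R :> R[i].
  rewrite -sum1_card natr_sum [RHS]big_mkcond [LHS]big_mkcond.
  apply: eq_bigr => c _; rewrite inE.
  by case: (child u c); case: (diag_eq w c).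
by rewrite !cnt => /eqP; rewrite eqr_nat => /eqP.
Qed.

(** * Commutation of T with the rooted automorphisms *)

Lemma rooted_autP s : s \in rooted_aut e x0 ->
  s x0 = x0 /\ forall x y, e (s x) (s y) = e x y.
Proof.
rewrite inE => /andP[/eqP s0 /forallP sP]; split=> // x y.
exact: (eqP (forallP (sP x) y)).
Qed.

Lemma rooted_aut_gdist s x : s \in rooted_aut e x0 -> d (s x) = d x.
Proof.
(* No automorphism increases the level; the inverse gives equality. *)
have le_d t y : t \in rooted_aut e x0 -> (d (t y) <= d y)%N.
  case/rooted_autP=> t0 tP; elim/(@parent_ind _ _ x0 tree_e): y => [|y y0 IHy].
    by rewrite t0.
  have [epy ->] := parentP tree_e y0; rewrite -tP in epy.
  exact: leq_trans (gdist_edge x0 tree_e epy) _.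
move=> sG; apply/eqP; rewrite eqn_leq le_d //=.
have sVG : (s^-1)%g \in rooted_aut e x0
  by rewrite (groupV (rooted_aut_group e x0)).
by have := le_d _ (s x) sVG; rewrite permK.
Qed.

Lemma rooted_aut_child s z c :
  s \in rooted_aut e x0 -> child (s z) (s c) = child z c.
Proof.
move=> sG; rewrite !(childE x0 tree_e) !rooted_aut_gdist //.
by have [_ ->] := rooted_autP sG.
Qed.

Lemma terwilliger_equivariant t s (v : V) :
  T t -> s \in rooted_aut e x0 ->
  t [ffun x => v (s x)] = [ffun x => t v (s x)].
Proof.
move=> Tt sG; elim: Tt v => {t}
  [t [->|[i _ ->]]||a f _ IHf|f g _ IHf _ IHg|f g _ IHf _ IHg] v.
- apply/ffunP=> x; rewrite [RHS]ffunE !adjopE [RHS](reindex_inj (@perm_inj _ s)).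
  by apply: eq_bigr => y _; rewrite ffunE; have [_ ->] := rooted_autP sG.
- apply/ffunP=> x; rewrite [RHS]ffunE !dual_idemE ffunE.
  by rewrite rooted_aut_gdist.
- by rewrite id_lfunE; apply/ffunP=> x; rewrite !ffunE id_lfunE.
- by rewrite scale_lfunE IHf; apply/ffunP=> x; rewrite !ffunE scale_lfunE ffunE.
- by rewrite add_lfunE IHf IHg; apply/ffunP=> x; rewrite !ffunE add_lfunE ffunE.
- by rewrite comp_lfunE IHg IHf; apply/ffunP=> x; rewrite !ffunE comp_lfunE.
Qed.

Lemma rooted_aut_diag_eq s x : s \in rooted_aut e x0 -> diag_eq x (s x).
Proof.
move=> sG; apply/diag_eqP => g [t Tt tE].
(* Applied to the all-ones vector, multiplication by g returns g. *)
have /ffunP/(_ x) := terwilliger_equivariant [ffun=> 1] Tt sG.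
by rewrite [RHS]ffunE !tE !ffunE !mulr1.
Qed.

(** * Orbits and their span *)

Local Notation orb := (orbit 'P (rooted_aut e x0)).

Lemma mem_orbP x y :
  reflect (exists2 s, s \in rooted_aut e x0 & s x = y) (y \in orb x).
Proof. by apply: (iffP orbitP) => -[s sG sx]; exists s. Qed.

Lemma orb_parent x y : x != x0 ->
  (y \in orb x) = [&& y != x0, parent y \in orb (parent x) & diag_eq x y].
Proof.
move=> x_neq0; apply/mem_orbP/and3P => [[s sG <-]|[y0 /mem_orbP[s sG sx] xy]].
  have := child_parent e x_neq0; rewrite -(rooted_aut_child _ _ sG).
  case/andP=> -> /eqP->; split=> //; last exact: rooted_aut_diag_eq.
  by apply/mem_orbP; exists s.
(* Now s x and y are equivalent siblings, so a further automorphism takes one to the other. *)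
have sxy : diag_eq (s x) y.
  by apply: diag_eq_trans xy; rewrite diag_eq_sym rooted_aut_diag_eq.
have [||u uG uxy] := swap_transport tree_e diag_eq_refl diag_eq_sym
  diag_eq_trans diag_eq_count _ _ sxy (p := parent y).
- by rewrite -sx rooted_aut_child // child_parent.
- exact: child_parent.
exists (s * u)%g; last by rewrite permM.
exact: (groupM (G := rooted_aut_group e x0)).
Qed.

Lemma vsumE (Y : {set X}) x : vsum R Y x = (x \in Y)%:R.
Proof.
rewrite sum_ffunE; case: (boolP (x \in Y)) => Yx.
  rewrite (bigD1 x) //= big1 ?addr0 ?ffunE ?eqxx // => y /andP[_ yx].
  by rewrite ffunE eq_sym (negPf yx).
rewrite big1 // => y Yy; rewrite ffunE; case: eqP => // xy.
by rewrite xy Yy in Yx.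
Qed.

Lemma principal_module_orb x : principal_module e x0 (vsum R (orb x)).
Proof.
elim/(@parent_ind _ _ x0 tree_e): x => [|x x_neq0 [t Tt tE]].
  exists \1%VF; first exact: gen_alg_id.
  rewrite id_lfunE; apply/ffunP=> x; rewrite vsumE ffunE; congr ((nat_of_bool _)%:R).
  apply/mem_orbP/eqP => [[s /rooted_autP[s0 _] <-] //|->].
  by exists 1%g; rewrite ?perm1 // (group1 (rooted_aut_group e x0)).
have [r Tr rE] := raising_op; have [m Tm mE] := diagonal_class x.
exists (m \o (r \o t))%VF; first by do !apply: gen_alg_comp.
apply/ffunP=> y; rewrite !comp_lfunE mE rE -tE !vsumE orb_parent //.
by case: eqP; case: (diag_eq x y); rewrite ?andbT ?andbF ?mulr0 ?mul0r ?mul1r.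
Qed.

Lemma principal_module0 : principal_module e x0 (0 : V).
Proof. by exists 0; [exact: terwilliger0 | rewrite zero_lfunE]. Qed.

Lemma principal_moduleD (u v : V) : principal_module e x0 u ->
  principal_module e x0 v -> principal_module e x0 (u + v).
Proof.
move=> [t Tt ->] [s Ts ->]; exists (t + s); last by rewrite add_lfunE.
exact: gen_alg_add.
Qed.

Lemma principal_moduleZ a (v : V) :
  principal_module e x0 v -> principal_module e x0 (a *: v).
Proof.
move=> [t Tt ->]; exists (a *: t); last by rewrite scale_lfunE.
exact: gen_alg_scale.
Qed.

Lemma invariant_span (v : V) :
  (forall s x, s \in rooted_aut e x0 -> v (s x) = v x) ->
  v \in <<[seq @vsum R X Y | Y in rooted_orbits e x0]>>%VS.
Proof.
move=> v_inv.
(* Each coefficient is the value of v at a representative; orbits are nonempty, so the default 0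
   never occurs. *)
have -> : v = \sum_(Y in rooted_orbits e x0)
                (if [pick y in Y] is Some y then v y else 0) *: vsum R Y.
  apply/ffunP=> x; rewrite sum_ffunE.
  have xx : x \in orb x by apply: (orbit_refl _ (rooted_aut_group e x0)).
  rewrite (bigD1 (orb x)) ?imset_f //= big1 ?addr0 => [|Y /andP[/imsetP[z _ ->]]].
    rewrite ffunE vsumE xx; case: pickP => [y /mem_orbP[s sG <-]|/(_ x)].
      by rewrite v_inv // [RHS]mulr1.
    by rewrite xx.
  rewrite ffunE vsumE; case: (boolP (x \in orb z)) => [xz|_ _].
    by rewrite (orbit_eqP (G := rooted_aut_group e x0) xz) eqxx.
  exact: mulr0.
by apply: memv_suml => Y OY; apply/memvZ/memv_span/imageP; exists Y.
Qed.

End PrincipalModule.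

Theorem theorem4 (R : realType) (X : finType) (e : rel X) (x0 : X)
    (tree_e : is_tree e) (v : stdmod R X) :
  principal_module e x0 v <->
  v \in <<[seq @vsum R X Y | Y in rooted_orbits e x0]>>%VS.
Proof.
split=> [[t Tt ->]|/coord_span->].
  apply: invariant_span => s x sG.
  (* The base vector is invariant because s fixes [x0]. *)
  have /ffunP/(_ x) := terwilliger_equivariant tree_e (vtx R x0) Tt sG.
  rewrite [RHS]ffunE => <-; congr (t _ x); apply/ffunP=> y; rewrite !ffunE.
  by have [s0 _] := rooted_autP sG; rewrite -{1}s0 (inj_eq perm_inj).
elim/big_ind: _ => [||i _]; first exact: principal_module0.
  exact: principal_moduleD.
apply: principal_moduleZ; set w := _`_i.
have /imageP[_ /imsetP[x _ ->] ->] :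
    w \in [seq vsum R Y | Y in rooted_orbits e x0].
  by apply: mem_nth; have := ltn_ord i; rewrite size_image.
exact: principal_module_orb.
Qed.
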